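(* Any triangle-free graph on $n\ge2$ vertices with $m\ge1$ edges and $w_3$ directed three-edge walks contains a bipartite induced subgraph of minimum degree at least $w_3/(4nm)$.
   Context: A directed three-edge walk in a graph is a sequence $(v_0,v_1,v_2,v_3)$ of vertices with $v_{i-1}v_i$ an edge for $i=1,2,3$; equivalently $w_3$ is the sum of all entries of $A^3$, where $A$ is the adjacency matrix. A bipartite induced subgraph is a subgraph induced by a nonempty vertex set which is bipartite. *)

(* Defs.v *)
From mathcomp Require Import all_boot all_order all_algebra.

Set Implicit Arguments.
Unset Strict Implicit.
Unset Printing Implicit Defensive.

(* Finite simple graphs. *)
Record sgraph := SGraph {
  vertex :> finType;
  adj : rel vertex;
  adj_sym : symmetric adj;
  adj_irr : irreflexive adj
}.

Definition edges (G : sgraph) : {set {set G}} :=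
  [set E | [exists x, exists y, adj x y && (E == [set x; y])]].

(* A walk is the sequence of its k.+1 vertices: [sorted r s] says that
   consecutive entries of s are related by r. *)
Definition walks (G : sgraph) (k : nat) : {set k.+1.-tuple G} :=
  [set w : k.+1.-tuple G | sorted (@adj G) w].

Definition triangle_free (G : sgraph) : Prop :=
  forall x y z : G, ~ [/\ adj x y, adj y z & adj z x].

Definition bipartite (G : sgraph) : Prop :=
  exists c : G -> bool, forall x y : G, adj x y -> c x != c y.

Definition degree (G : sgraph) (x : G) : nat := #|[set y | adj x y]|.

(* The default value #|G| exceeds every degree, so it is the value of the
   minimum only when G has no vertex. *)
Definition min_degree (G : sgraph) : nat :=
  \big[minn/#|G|]_(x : G) degree x.

Section Induced.
Variables (G : sgraph) (S : {set G}).

Definition induced_adj : rel {x : G | x \in S} :=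
  fun x y => adj (val x) (val y).

Lemma induced_sym : symmetric induced_adj.
Proof. by move=> x y; apply: adj_sym. Qed.

Lemma induced_irr : irreflexive induced_adj.
Proof. by move=> x; apply: adj_irr. Qed.

Definition induced : sgraph := SGraph induced_sym induced_irr.

End Induced.

(* Main.v *)
Require Import Defs.
From mathcomp Require Import all_boot all_order all_algebra.
From mathcomp Require Import zify.

(** Write N(a) for the neighbourhood of a and e(a, b) for the number of edges
    (x, y) with x in N(a) and y in N(b). Summed over all pairs (a, b), e(a, b)
    counts the three-edge walks, with total w3, while |N(a)| + |N(b)| has total
    4nm; hence some pair has a nonempty S = N(a) :|: N(b) and
    e(a, b) / |S| >= w3 / (4nm). As G is triangle-free, N(a) and N(b) are
    independent, so S induces a bipartite graph (vertices of the intersection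
    are isolated in it) with e(a, b) edges. A minimal nonempty subset
    of S with this edge density has minimum degree at least w3 / (4nm), since
    deleting a vertex of smaller degree would not decrease the density. *)

Definition nbh (G : sgraph) (x : G) : {set G} := [set y | adj x y].

(** Pairs are ordered, so [arcs G S S] counts each edge inside [S] twice; hence the factor in the
    density condition [w * (2 * #|S|)]. *)
Definition arcs (G : sgraph) (A B : {set G}) : {set G * G} :=
  [set p | [&& p.1 \in A, p.2 \in B & adj p.1 p.2]].

Lemma arcsC (G : sgraph) (A B : {set G}) : #|arcs G A B| = #|arcs G B A|.
Proof.
have swap_inj : injective (fun p : G * G => (p.2, p.1)).
  by move=> [x y] [u v] [-> ->].
rewrite -(card_imset _ swap_inj).
apply: eq_card => -[x y]; apply/imsetP/idP => [[[u v] + [-> ->]]|].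
  by rewrite !inE /= => /and3P[-> ->]; rewrite adj_sym => ->.
rewrite inE /= => /and3P[xB yA xy]; exists (y, x) => //.
by rewrite !inE /= xB yA adj_sym.
Qed.

(** An arc that is lost has [x] as its first or second end, and its other end is a neighbour of [x]
    in [S]. *)
Lemma arcs_setD1 (G : sgraph) (S : {set G}) (x : G) :
  #|arcs G S S| <= #|arcs G (S :\ x) (S :\ x)| + 2 * #|S :&: nbh G x|.
Proof.
have sub : arcs G S S \subset
    arcs G (S :\ x) (S :\ x) :|:
    ([set (x, y) | y in S :&: nbh G x] :|: [set (y, x) | y in S :&: nbh G x]).
  apply/subsetP => -[u v]; rewrite !inE /= => /and3P[uS vS uv].
  have [ux|ux] := eqVneq u x.
    apply/orP; right; apply/orP; left; apply/imsetP; exists v; last by rewrite ux.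
    by rewrite !inE vS -ux.
  have [vx|vx] := eqVneq v x; last by rewrite uS vS uv.
  apply/orP; right; apply/orP; right; apply/imsetP; exists u; last by rewrite vx.
  by rewrite !inE uS -vx adj_sym.
set N := S :&: nbh G x in sub *.
apply: leq_trans (subset_leq_card sub) _; apply: leq_trans (leq_card_setU _ _) _.
rewrite leq_add2l mul2n -addnn; apply: leq_trans (leq_card_setU _ _) _.
by apply: leq_add; apply: leq_imset_card.
Qed.

Lemma dense_subset (G : sgraph) (w D : nat) (S : {set G}) :
  S != set0 -> w * (2 * #|S|) <= #|arcs G S S| * D ->
  exists T : {set G}, [/\ T != set0, T \subset S &
    forall x, x \in T -> w <= #|T :&: nbh G x| * D].
Proof.
have [n] := ubnP #|S|; elim: n S => // n IHn S; rewrite ltnS => Sn S0 dense.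
have [/forall_inP ok|] := boolP [forall x in S, w <= #|S :&: nbh G x| * D].
  by exists S; split.
case/forall_inPn => x xS; rewrite -ltnNge => small.
have cS := cardsD1 x S; rewrite xS in cS.
have arcsD := leq_mul (arcs_setD1 G S x) (leqnn D).
(* Deleting [x] lowers the left side by [2 * w] and the right side by less than that. The resulting
   strictness rules out an empty remainder. *)
have dense' : w * (2 * #|S :\ x|) < #|arcs G (S :\ x) (S :\ x)| * D by nia.
have S'0 : S :\ x != set0.
  apply: contraTneq dense' => ->; rewrite -leqNgt.
  suff -> : arcs G set0 set0 = set0 by rewrite !cards0.
  by apply/setP => p; rewrite !inE.
have [|T [T0 TS okT]] := IHn (S :\ x) _ S'0 (ltnW dense'); first by lia.
by exists T; split=> //; apply: subset_trans TS (subsetDl _ _).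
Qed.

Lemma min_degree_induced (G : sgraph) (w D : nat) (T : {set G}) :
  T != set0 -> (forall x, x \in T -> w <= #|T :&: nbh G x| * D) ->
  w <= min_degree (induced T) * D.
Proof.
move=> /set0Pn[x0 x0T] ok.
have degE (x : induced T) : w <= degree x * D.
  apply: leq_trans (ok (val x) (valP x)) _; rewrite leq_mul2r; apply/orP; right.
  rewrite /degree -(card_imset _ val_inj); apply/subset_leq_card/subsetP => y.
  rewrite !inE => /andP[yT xy]; apply/imsetP.
  by exists (exist _ y yT : induced T); rewrite ?inE.
rewrite /min_degree; elim/big_ind: _ => //.
(* The default value of the minimum must obey the bound too; it is at least the degree of [x0]. *)
- apply: leq_trans (degE (exist _ x0 x0T : induced T)) _.
  by rewrite leq_mul2r max_card orbT.
- by move=> a b; rewrite /minn; case: ifP.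
Qed.

Lemma sum_nbh_leq (G : sgraph) : \sum_(x : G) #|nbh G x| <= 2 * #|edges G|.
Proof.
have -> : \sum_(x : G) #|nbh G x| = \sum_(p : G * G | adj p.1 p.2) 1.
  rewrite -(pair_big_dep xpredT (fun x y : G => adj x y) (fun _ _ => 1)) /=.
  apply: eq_bigr => x _; rewrite sum1dep_card.
  by apply: eq_card => y; rewrite !inE.
(* Group the ordered adjacent pairs by their underlying edge; a fibre contains only [(x, y)] and
   [(y, x)]. *)
rewrite (partition_big (fun p : G * G => [set p.1; p.2]) (mem (edges G))) /=; last first.
  by move=> [x y] /= xy; rewrite inE; apply/existsP; exists x;
    apply/existsP; exists y; rewrite xy eqxx.
rewrite mulnC -sum_nat_const; apply: leq_sum => E.
rewrite inE => /existsP[x /existsP[y /andP[xy /eqP ->]]].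
rewrite sum1dep_card; apply: (@leq_trans #|[set (x, y); (y, x)]|); last first.
  by rewrite cards2; case: (_ != _).
apply/subset_leq_card/subsetP => -[u v]; rewrite !inE /= => /andP[uv /eqP uvE].
have : u \in [set x; y] by rewrite -uvE !inE eqxx.
have : v \in [set x; y] by rewrite -uvE !inE eqxx orbT.
rewrite !inE => /orP[] /eqP vE /orP[] /eqP uE; move: uv; rewrite vE uE.
- by rewrite adj_irr.
- by rewrite eqxx orbT.
- by rewrite eqxx.
- by rewrite adj_irr.
Qed.

(** Group the walks by their ends [(a, b)]: the two middle vertices form an arc from N(a) to N(b)
    and, once the ends are fixed, determine the walk. *)
Lemma card_walks3_leq (G : sgraph) :
  #|walks G 3| <= \sum_(p : G * G) #|arcs G (nbh G p.1) (nbh G p.2)|.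
Proof.
rewrite -sum1_card.
rewrite (partition_big (fun t : 4.-tuple G =>
  (tnth t (@Ordinal 4 0 isT), tnth t (@Ordinal 4 3 isT))) xpredT) //=.
apply: leq_sum => -[a b] _; rewrite sum1dep_card /=.
pose mid (t : 4.-tuple G) :=
  (tnth t (@Ordinal 4 1 isT), tnth t (@Ordinal 4 2 isT)).
rewrite -(@card_in_imset _ _ mid); last first.
  move=> s t; rewrite !inE => /andP[_ /eqP[sa sb]] /andP[_ /eqP[ta tb]] [s1 s2].
  apply: eq_from_tnth => -[[|[|[|[|//]]]] i];
    rewrite (bool_irrelevance i isT) //; congruence.
apply/subset_leq_card/subsetP => p /imsetP[t].
case: t => -[|x0 [|x1 [|x2 [|x3 [|//]]]]] // st.
rewrite !inE /mid !(tnth_nth x0) /= => /andP[].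
rewrite andbT => /and3P[x01 x12 x23] /eqP[<- <-] -> /=.
by rewrite x01 x12 adj_sym x23.
Qed.

Lemma dense_pair (G : sgraph) : 0 < #|edges G| ->
  exists a b : G, 0 < #|nbh G a| + #|nbh G b| /\
    #|walks G 3| * (#|nbh G a| + #|nbh G b|) <=
      #|arcs G (nbh G a) (nbh G b)| * (4 * #|G| * #|edges G|).
Proof.
move=> /card_gt0P[E]; rewrite inE => /existsP[x /existsP[y /andP[xy _]]].
set w := #|walks G 3|; set D := 4 * _ * _.
pose s (p : G * G) := #|nbh G p.1| + #|nbh G p.2|.
pose c (p : G * G) := #|arcs G (nbh G p.1) (nbh G p.2)|.
have [/existsP[[a b] /andP[s_gt0 le]]|] :=
  boolP [exists p, (0 < s p) && (w * s p <= c p * D)]; first by exists a, b.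
rewrite negb_exists => /forallP none; exfalso.
have lt p : 0 < s p -> c p * D < w * s p.
  by move=> sp; have := none p; rewrite sp /= -ltnNge.
(* If [s p = 0], the neighbourhoods are empty and there are no arcs either. *)
have le p : c p * D <= w * s p.
  have [s0|/lt/ltnW//] := posnP (s p).
  suff -> : c p = 0 by [].
  have /eqP : #|nbh G p.1| = 0 by move: s0; rewrite /s; lia.
  rewrite cards_eq0 => /eqP N0; rewrite /c N0.
  by apply: eq_card0 => q; rewrite !inE.
(* The vertex [x] lies on an edge, so the term at [(x, x)] is strict. Bounding the two sums will
   turn this into [w * D < w * D]. *)
have sumlt : (\sum_p c p) * D < w * \sum_p s p.
  rewrite big_distrl big_distrr /= (bigD1 (x, x)) // [ltnRHS](bigD1 (x, x)) //=.
  rewrite -addSn leq_add ?leq_sum // lt // /s addn_gt0.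
  by apply/orP; left; apply/card_gt0P; exists y; rewrite inE.
have sumc : w <= \sum_p c p := card_walks3_leq G.
have sumsE : \sum_p s p = 2 * #|G| * \sum_(x : G) #|nbh G x|.
  rewrite -(pair_bigA _ (fun a b => #|nbh G a| + #|nbh G b|)) /=.
  under eq_bigr do rewrite big_split /= sum_nat_const.
  rewrite big_split /= -big_distrr /= sum_nat_const.
  by rewrite addnn -mul2n mulnA.
have sums : \sum_p s p <= D.
  rewrite sumsE; apply: leq_trans (leq_mul (leqnn _) (sum_nbh_leq G)) _.
  by rewrite mulnA (mulnAC 2).
have := leq_mul (leqnn w) sums; have := leq_mul sumc (leqnn D); lia.
Qed.

(** Colour by membership in N(a): vertices of [T] outside N(a) lie in N(b), and no edge has both
    ends in one neighbourhood. *)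
Lemma nbhU_bipartite (G : sgraph) (a b : G) (T : {set G}) :
  triangle_free G -> T \subset nbh G a :|: nbh G b -> bipartite (induced T).
Proof.
move=> tfree /subsetP TS; exists (fun x => adj a (val x)) => -[x xT] [y yT].
rewrite /= /induced_adj /= => xy.
have tf (c u v : G) : adj u v -> ~~ (adj c u && adj c v).
  by move=> uv; apply/negP => /andP[cu cv]; case: (tfree c u v); split=> //; rewrite adj_sym.
have := TS _ xT; have := TS _ yT; rewrite !inE.
have := tf a _ _ xy; have := tf b _ _ xy.
by case: (adj a x); case: (adj a y); case: (adj b x); case: (adj b y).
Qed.

(** The arcs from N(a) to N(b) and their reverses are disjoint families: a common arc would have
    both ends in N(a) and close a triangle with [a]. *)
Lemma arcs_nbhU (G : sgraph) (a b : G) : triangle_free G ->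
  2 * #|arcs G (nbh G a) (nbh G b)| <=
    #|arcs G (nbh G a :|: nbh G b) (nbh G a :|: nbh G b)|.
Proof.
move=> tfree; rewrite mul2n -addnn {2}arcsC.
rewrite -cardsUI.
have -> : arcs G (nbh G a) (nbh G b) :&: arcs G (nbh G b) (nbh G a) = set0.
  apply/setP => -[x y]; rewrite !inE /=; apply/negP.
  move=> /andP[/and3P[ax _ xy] /and3P[_ ay _]].
  by apply: (tfree a x y); split=> //; rewrite adj_sym.
rewrite cards0 addn0; apply/subset_leq_card/subsetP => -[x y].
by rewrite !inE /= => /orP[] /and3P[-> -> ->]; rewrite ?orbT.
Qed.

Theorem theorem1p5 (G : sgraph) (n m w3 : nat)
  (hn : n = #|G|) (hm : m = #|edges G|) (hw : w3 = #|walks G 3|)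
  (n_ge2 : (2 <= n)%N) (m_ge1 : (1 <= m)%N) (tfree : triangle_free G) :
  exists S : {set G},
    [/\ S != set0, bipartite (induced S) &
      (w3%:R / (4 * n * m)%:R <= (min_degree (induced S))%:R :> rat)%R].
Proof.
have [|a [b []]] := dense_pair G; first by rewrite -hm.
rewrite -hn -hm -hw => ab_gt0 dense.
have [cU _] := leq_card_setU (nbh G a) (nbh G b).
have U0 : nbh G a :|: nbh G b != set0.
  by rewrite setU_eq0 -!cards_eq0; move: ab_gt0; lia.
(* The doubling of arcs supplies the factor 2 of the density condition; an overlap of the
   neighbourhoods only makes the union smaller. *)
have denseU := leq_mul (arcs_nbhU G a b tfree) (leqnn (4 * n * m)).
have cU' := leq_mul (leqnn w3) cU.
have [|T [T0 TU degT]] := dense_subset G w3 (4 * n * m) _ U0; first by lia.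
exists T; split=> //; first exact: nbhU_bipartite _ _ _ tfree TU.
have D_gt0 : 0 < 4 * n * m by rewrite !muln_gt0 m_ge1; lia.
rewrite Num.Theory.ler_pdivrMr ?Num.Theory.ltr0n //.
by rewrite -GRing.natrM Num.Theory.ler_nat min_degree_induced.
Qed.
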